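(* If $x$ is an $m$-th root of unity, where $m$ is a positive integer with $m\equiv 0\pmod 5$, then the continued fraction $K(x)$ converges generally.
   Context: For $x\in\mathbb{C}$, $K(x)$ is the continued fraction $$K(x)=1+\cfrac{x}{1+\cfrac{x^2}{1+\cfrac{x^3}{1+\ddots}}}.$$ Its $n$-th convergent is $P_n(x)/Q_n(x)$, where $P_0=1$, $P_1=1+x$, $Q_0=Q_1=1$, and $P_{n+1}(x)=P_n(x)+x^{n+1}P_{n-1}(x)$, $Q_{n+1}(x)=Q_n(x)+x^{n+1}Q_{n-1}(x)$ for $n\ge1$. Let $\hat{\mathbb{C}}=\mathbb{C}\cup\{\infty\}$, with the chordal metric $d(w,z)=\dfrac{|z-w|}{\sqrt{1+|w|^2}\sqrt{1+|z|^2}}$ for finite $w,z$, $d(w,\infty)=\dfrac{1}{\sqrt{1+|w|^2}}$ for finite $w$, and $d(\infty,\infty)=0$. For a continued fraction $b_0+\cfrac{a_1}{b_1+\cfrac{a_2}{b_2+\ddots}}$ with $n$-th convergent $A_n/B_n$, put $$S_n(w)=b_0+\cfrac{a_1}{b_1+\ddots+\cfrac{a_n}{b_n+w}}=\frac{A_n+wA_{n-1}}{B_n+wB_{n-1}},\qquad S_n(\infty)=\frac{A_{n-1}}{B_{n-1}}.$$ The continued fraction converges generally to $f\in\hat{\mathbb{C}}$ if there exist sequences $\{v_n\},\{w_n\}\subset\hat{\mathbb{C}}$ with $\liminf_{n\to\infty} d(v_n,w_n)>0$ and $\lim_{n\to\infty}S_n(v_n)=\lim_{n\to\infty}S_n(w_n)=f$.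 It converges generally if it converges generally to some $f\in\hat{\mathbb{C}}$. *)

(* Defs.v *)
From HB Require Import structures.
From mathcomp Require Import all_boot all_order all_algebra.
From mathcomp Require Import complex.
From mathcomp Require Import all_classical all_reals all_analysis.

Set Implicit Arguments.
Unset Strict Implicit.
Unset Printing Implicit Defensive.

Import Order.TTheory GRing.Theory Num.Theory.
Import numFieldNormedType.Exports.

Local Open Scope classical_set_scope.
Local Open Scope ring_scope.
Local Open Scope complex_scope.
Local Notation normc := ComplexField.Normc.normc.

(* The extended complex plane; None is the point at infinity. *)
Definition riemann_sphere (R : realType) : Type := option R[i].

(* normc is the complex modulus with values in R; the generic norm `|z| of
   R[i] is valued in R[i]. *)
Definition chordal_dist (R : realType) (w z : riemann_sphere R) : R :=
  match w, z with
  | Some w, Some z =>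
      normc (z - w) / (Num.sqrt (1 + normc w ^+ 2) * Num.sqrt (1 + normc z ^+ 2))
  | Some w, None => 1 / Num.sqrt (1 + normc w ^+ 2)
  | None, Some z => 1 / Num.sqrt (1 + normc z ^+ 2)
  | None, None => 0
  end.

(* The quotient p / q in the extended plane. It is only meaningful when p and q
   are not both zero; this holds for the values taken by cf_S below as soon as
   all the partial numerators a n, n >= 1, are nonzero. *)
Definition sphere_quot (R : realType) (p q : R[i]) : riemann_sphere R :=
  if q == 0 then None else Some (p / q).

(* A continued fraction b_0 + a_1 / (b_1 + a_2 / (b_2 + ...)) is given by
   a, b : nat -> R[i]; the value a 0 is never used.
   cf_rec a b u' u is the solution (u_n)_(n >= 0) of
   u_n = b_n u_(n-1) + a_n u_(n-2), n >= 1, with u_(-1) = u' and u_0 = u. *)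
Fixpoint cf_rec (R : realType) (a b : nat -> R[i]) (u' u : R[i]) (n : nat)
    : R[i] :=
  if n is n1.+1 then
    b n * cf_rec a b u' u n1
      + a n * (if n1 is n2.+1 then cf_rec a b u' u n2 else u')
  else u.

Definition cf_num (R : realType) (a b : nat -> R[i]) (n : nat) : R[i] :=
  cf_rec a b 1 (b 0) n.

Definition cf_den (R : realType) (a b : nat -> R[i]) (n : nat) : R[i] :=
  cf_rec a b 0 1 n.

(* A_(n-1) and B_(n-1), with A_(-1) = 1 and B_(-1) = 0. *)
Definition cf_num_pred (R : realType) (a b : nat -> R[i]) (n : nat) : R[i] :=
  if n is n1.+1 then cf_num a b n1 else 1.

Definition cf_den_pred (R : realType) (a b : nat -> R[i]) (n : nat) : R[i] :=
  if n is n1.+1 then cf_den a b n1 else 0.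

Definition cf_S (R : realType) (a b : nat -> R[i]) (n : nat)
    (w : riemann_sphere R) : riemann_sphere R :=
  match w with
  | Some w => sphere_quot (cf_num a b n + w * cf_num_pred a b n)
                          (cf_den a b n + w * cf_den_pred a b n)
  | None => sphere_quot (cf_num_pred a b n) (cf_den_pred a b n)
  end.

(* The chordal distance is bounded, so limn_inf below is the actual lower limit
   (no junk value from an unbounded sequence). *)
Definition cf_converges_generally_to (R : realType) (a b : nat -> R[i])
    (f : riemann_sphere R) : Prop :=
  exists v w : nat -> riemann_sphere R,
    [/\ 0 < limn_inf (fun n => chordal_dist (v n) (w n)),
        (fun n => chordal_dist (cf_S a b n (v n)) f) @ \oo --> (0 : R)
      & (fun n => chordal_dist (cf_S a b n (w n)) f) @ \oo --> (0 : R)].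

Definition cf_converges_generally (R : realType) (a b : nat -> R[i]) : Prop :=
  exists f : riemann_sphere R, cf_converges_generally_to a b f.

(* Coefficients of K(x): a_n = x^n and b_n = 1. *)
Definition K_num (R : realType) (x : R[i]) (n : nat) : R[i] := x ^+ n.

Definition K_den (R : realType) (n : nat) : R[i] := 1.

Definition K_P (R : realType) (x : R[i]) : nat -> R[i] :=
  cf_num (K_num x) (@K_den R).

Definition K_Q (R : realType) (x : R[i]) : nat -> R[i] :=
  cf_den (K_num x) (@K_den R).

Lemma K_P_rec (R : realType) (x : R[i]) :
  [/\ K_P x 0 = 1, K_P x 1 = 1 + x &
      forall n, K_P x n.+2 = K_P x n.+1 + x ^+ n.+2 * K_P x n].
Proof.
split=> [||n]; rewrite /K_P /cf_num //=.
  by rewrite /K_den /K_num !mulr1 expr1.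
by rewrite /K_den mul1r.
Qed.

Lemma K_Q_rec (R : realType) (x : R[i]) :
  [/\ K_Q x 0 = 1, K_Q x 1 = 1 &
      forall n, K_Q x n.+2 = K_Q x n.+1 + x ^+ n.+2 * K_Q x n].
Proof.
split=> [||n]; rewrite /K_Q /cf_den //=.
  by rewrite /K_den mulr0 addr0 mulr1.
by rewrite /K_den mul1r.
Qed.

Definition K_converges_generally (R : realType) (x : R[i]) : Prop :=
  cf_converges_generally (K_num x) (@K_den R).

(* Main.v *)
Require Import Defs.
From HB Require Import structures.
From mathcomp Require Import all_boot all_order all_algebra.
From mathcomp Require Import ring lra.
From mathcomp Require Import complex.
From mathcomp Require Import all_classical all_reals all_analysis.

Set Implicit Arguments.
Unset Strict Implicit.
Unset Printing Implicit Defensive.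

Import Order.TTheory GRing.Theory Num.Theory.

Local Open Scope ring_scope.
Local Open Scope complex_scope.

Import numFieldNormedType.Exports.
Local Open Scope classical_set_scope.
Local Notation normc := ComplexField.Normc.normc.

(**
A root of unity [x] of order [d] makes the coefficients of K(x) periodic with
period [d], so that the maps S_n are, up to a fixed change of coordinate and
fewer than [d] further steps, powers of one Moebius transformation.  Let M be
the product of the step matrices of a period.  The point is that M has
determinant -1 and trace 1 for every [d]: its eigenvalues are then the roots
(1 + sqrt 5) / 2 and (1 - sqrt 5) / 2 of X^2 - X - 1, whose moduli differ, so
M has an attracting fixed point.

The determinant is the product of the numbers - x^i over a period, which is
the value at 0 of X^d - 1 ([det_cf_mx_root_of_unity]).  For the trace
([tr_cf_mx_root_of_unity]), replace the numerators x^n by x^n z.  The trace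
t(z) is a polynomial in z, of degree less than [d] ([size_tr_cf_mx]).
Replacing z by x z shifts the period by one step, which does not affect the
trace of the product ([tr_cf_mx_rot]).  Hence t takes the same value at the
[d] distinct powers of x and must be constant; and t(0) = 1.

Two eigenvalues of different moduli imply general convergence of any periodic
continued fraction with nonzero numerators
([periodic_cf_converges_generally]).  Let [f] and [g] be eigenvectors
of M for the larger and the smaller eigenvalue, and N_r the product of the
first r steps.  For n = r + k d with r < d, take for v_n and w_n the points
that N_r sends to f and to f + g.  These depend on r only, so their chordal
distance takes finitely many positive values.  The remaining k periods fix f
and send f + g to lam^k f + mu^k g, which tends to f geometrically
([chordal_power_iteration]).

Points of the sphere are represented by nonzero row vectors (p, q), standing
for p / q, and matrices act on them from the right; the chordal distance is
then |p q' - q p'| divided by the two Euclidean norms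
([chordal_sphere_point]), whatever the position of the point at infinity.
*)

(** * Two-by-two matrices *)

Lemma ord2P (i : 'I_2) : i = 0 \/ i = 1.
Proof. by case: i => [[|[|//]] lt_i]; [left|right]; apply: val_inj. Qed.

Lemma mulmx2E (S : pzSemiRingType) (m n : nat) (A : 'M[S]_(m, 2))
    (B : 'M[S]_(2, n)) (i : 'I_m) (j : 'I_n) :
  (A *m B) i j = A i 0 * B 0 j + A i 1 * B 1 j.
Proof.
rewrite mxE !big_ord_recl big_ord0 addr0.
by congr (_ + A i _ * B _ j); apply: val_inj.
Qed.

Lemma tr_mx2 (S : pzSemiRingType) (A : 'M[S]_2) : \tr A = A 0 0 + A 1 1.
Proof.
rewrite /mxtrace !big_ord_recl big_ord0 addr0.
by congr (_ + A _ _); apply: val_inj.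
Qed.

Lemma det_mx2 (S : comPzRingType) (A : 'M[S]_2) :
  \det A = A 0 0 * A 1 1 - A 0 1 * A 1 0.
Proof.
rewrite (expand_det_row _ 0) !big_ord_recl big_ord0 /cofactor !det_mx11 !mxE /=.
have -> : lift 0 0 = 1 :> 'I_2 by apply: val_inj.
have -> : lift 1 0 = 0 :> 'I_2 by apply: val_inj.
by rewrite /= addr0 expr0 expr1 mulN1r mul1r mulrN.
Qed.

Lemma eigenvalue_mx2 (F : fieldType) (A : 'M[F]_2) (c : F) :
  eigenvalue A c = (c ^+ 2 - \tr A * c + \det A == 0).
Proof.
rewrite eigenvalue_root_char /root /char_poly.
rewrite -[_.[c]]/(horner_eval c _) -det_map_mx det_mx2 !mxE.
rewrite /= /horner_eval !hornerE tr_mx2 det_mx2; congr (_ == 0).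
by ring.
Qed.

(** * Products of continued fraction steps *)

Section ContinuantMatrices.
Variable S : comNzRingType.
Implicit Types a b : nat -> S.

(** With this layout the two rows of a product of steps carry consecutive
convergents, the more recent one below; see [cf_mx_convergents]. *)
Definition cf_step (a b : S) : 'M[S]_2 :=
  \matrix_(i, j) if i == 0 then (j == 1)%:R else if j == 0 then a else b.

(** The latest step multiplies on the left, hence acts first on a row vector:
this is the innermost level of the continued fraction. *)
Fixpoint cf_mx a b n : 'M[S]_2 :=
  if n is n1.+1 then cf_step (a n) (b n) *m cf_mx a b n1 else 1%:M.

Lemma det_cf_step (a b : S) : \det (cf_step a b) = - a.
Proof. by rewrite det_mx2 !mxE /= mul0r mul1r sub0r. Qed.

Lemma det_cf_mx a b n : \det (cf_mx a b n) = \prod_(1 <= i < n.+1) (- a i).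
Proof.
elim: n => [|n IHn]; first by rewrite det1 big_geq.
by rewrite [LHS]/= det_mulmx IHn det_cf_step [in RHS]big_nat_recr //= mulrC.
Qed.

Lemma eq_cf_mx a b a' b' n :
    (forall i, (0 < i <= n)%N -> a i = a' i /\ b i = b' i) ->
  cf_mx a b n = cf_mx a' b' n.
Proof.
elim: n => [//|n IHn] eq_ab /=.
have [-> ->] := eq_ab n.+1 (leqnn _).
by rewrite IHn // => i /andP[i0 le_in]; apply: eq_ab; rewrite i0 leqW.
Qed.

Lemma cf_mxD a b m n :
  cf_mx a b (m + n) =
  cf_mx (fun i => a (i + n)%N) (fun i => b (i + n)%N) m *m cf_mx a b n.
Proof. by elim: m => [|m IHm]; rewrite ?mul1mx //= addSn /= IHm mulmxA. Qed.

(** Both products consist of the same factors up to moving one end factor to the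
other end, and a trace is invariant under cyclic permutation. *)
Lemma tr_cf_mx_rot a b n :
    a n.+1 = a 1 -> b n.+1 = b 1 ->
  \tr (cf_mx (fun i => a i.+1) (fun i => b i.+1) n) = \tr (cf_mx a b n).
Proof.
case: n => [//|n] an bn.
have := cf_mxD a b n 1; rewrite addn1.
have -> : cf_mx a b 1 = cf_step (a 1) (b 1) by rewrite /= mulmx1.
move=> ->; rewrite mxtrace_mulC /= an bn.
by congr (\tr (_ *m _)); apply: eq_cf_mx => i _; rewrite addn1.
Qed.

End ContinuantMatrices.

Lemma map_cf_mx (S T : comNzRingType) (h : {rmorphism S -> T})
    (a b : nat -> S) n :
  map_mx h (cf_mx a b n) = cf_mx (h \o a) (h \o b) n.
Proof.
elim: n => [|n IHn] /=; first exact: map_mx1.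
rewrite map_mxM IHn; congr (_ *m _); apply/matrixP=> i j; rewrite !mxE /=.
by case: ifP => _; [rewrite rmorph_nat | case: ifP].
Qed.

(** A monomial of the trace is a product of numerators with pairwise
non-adjacent indices, so the degree is in fact at most n / 2.  It only has to
be less than n in [tr_cf_mx_root_of_unity]; the bounds on the four entries
below are those preserved by a step. *)
Lemma size_tr_cf_mx (S : comNzRingType) (a b : nat -> {poly S}) n :
    (forall i, (size (a i) <= 2)%N) -> (forall i, (size (b i) <= 1)%N) ->
    (0 < n)%N ->
  (size (\tr (cf_mx a b n)) <= n)%N.
Proof.
move=> size_a size_b; case: n => [//|n] _.
have sizeM (p q : {poly S}) i k :
    (size p <= i.+1)%N -> (size q <= k)%N -> (size (p * q)%R <= i + k)%N.
  move=> pi qk; apply: leq_trans (size_polyMleq _ _) _.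
  by rewrite -subn1 leq_subLR add1n -addSn leq_add.
have sizeD (p q : {poly S}) k :
    (size p <= k)%N -> (size q <= k)%N -> (size (p + q)%R <= k)%N.
  by move=> pk qk; apply: leq_trans (size_polyD _ _) _; rewrite geq_max pk.
(* the lower left entry of the first step is a 1, of size up to 2 *)
suff: [/\ (size (cf_mx a b n.+1 0 0)%R <= n.+1)%N,
    (size (cf_mx a b n.+1 0 1)%R <= n.+1)%N,
    (size (cf_mx a b n.+1 1 0)%R <= n.+2)%N &
    (size (cf_mx a b n.+1 1 1)%R <= n.+1)%N].
  by case=> s00 _ _ s11; rewrite tr_mx2 sizeD.
elim: n => [|n [s00 s01 s10 s11]].
  by rewrite /= mulmx1 !mxE /= size_poly0 size_poly1.
rewrite [cf_mx _ _ n.+2]/= -/(cf_mx a b n.+1).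
move: (cf_mx a b n.+1) s00 s01 s10 s11 => M s00 s01 s10 s11.
rewrite !mulmx2E !mxE /= !mul0r !mul1r !add0r; split => //.
- exact: leqW s11.
- apply: sizeD; first exact: leqW (sizeM _ _ 1 _ (size_a _) s00).
  exact: leqW (sizeM _ _ 0 _ (size_b _) s10).
- apply: sizeD; first exact: (sizeM _ _ 1 _ (size_a _) s01).
  exact: leqW (sizeM _ _ 0 _ (size_b _) s11).
Qed.

(** * The Riemann sphere in homogeneous coordinates *)

Section SpherePoints.
Variable R : realType.
Local Notation C := R[i].
Implicit Types y z f g : 'rV[C]_2.

Definition sphere_point y : riemann_sphere R := sphere_quot (y 0 0) (y 0 1).

(** The determinant of the matrix with rows [y] and [z]; for nonzero vectors, it
vanishes exactly when the two points coincide. *)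
Definition wedge y z : C := y 0 0 * z 0 1 - y 0 1 * z 0 0.

Definition vnorm y : R := Num.sqrt (normc (y 0 0) ^+ 2 + normc (y 0 1) ^+ 2).

Lemma normc_ge0 (c : C) : 0 <= normc c.
Proof. by case: c => a b /=; rewrite sqrtr_ge0. Qed.

Lemma normc_eq0 (c : C) : (normc c == 0) = (c == 0).
Proof.
apply/eqP/eqP=> [/ComplexField.Normc.eq0_normc //|->].
exact: ComplexField.Normc.normc0.
Qed.

Lemma normcX (c : C) n : normc (c ^+ n) = normc c ^+ n.
Proof.
elim: n => [|n IHn]; first exact: ComplexField.Normc.normc1.
by rewrite !exprS ComplexField.Normc.normcM IHn.
Qed.

Lemma row2_eq0 y : (y == 0) = (y 0 0 == 0) && (y 0 1 == 0).
Proof.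
apply/eqP/andP=> [->|[/eqP y0 /eqP y1]]; first by rewrite !mxE eqxx.
by apply/rowP=> i; case: (ord2P i) => ->; rewrite mxE ?y0 ?y1.
Qed.

Lemma sphere_quotZ (c p q : C) :
  c != 0 -> sphere_quot (c * p) (c * q) = sphere_quot p q.
Proof.
move=> c_neq0; rewrite /sphere_quot mulf_eq0 (negPf c_neq0) /=.
by case: ifP => // _; rewrite -mulf_div divff // mul1r.
Qed.

Lemma sphere_point_scale (c : C) y :
  c != 0 -> sphere_point (c *: y) = sphere_point y.
Proof.
by move=> c_neq0; rewrite /sphere_point !mxE sphere_quotZ.
Qed.

Lemma vnorm_gt0 y : (0 < vnorm y) = (y != 0).
Proof.
rewrite /vnorm sqrtr_gt0 lt_def addr_ge0 ?exprn_ge0 ?normc_ge0 // andbT.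
by rewrite paddr_eq0 ?exprn_ge0 ?normc_ge0 // !sqrf_eq0 !normc_eq0 -row2_eq0.
Qed.

Lemma wedge_neq0l y z : wedge y z != 0 -> y != 0.
Proof. by apply: contraNneq => ->; rewrite /wedge !mxE !mul0r subrr. Qed.

Lemma wedge_neq0r y z : wedge y z != 0 -> z != 0.
Proof. by apply: contraNneq => ->; rewrite /wedge !mxE !mulr0 subrr. Qed.

Lemma wedgeM y z (A : 'M[C]_2) : wedge (y *m A) (z *m A) = wedge y z * \det A.
Proof. by rewrite /wedge !mulmx2E det_mx2; ring. Qed.

Lemma wedge_eq0 y z : y != 0 -> wedge y z = 0 -> exists c, z = c *: y.
Proof.
rewrite row2_eq0 negb_and /wedge => y_neq0 /eqP; rewrite subr_eq0 => /eqP yz.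
have row2_eqP c : z 0 0 = c * y 0 0 -> z 0 1 = c * y 0 1 -> z = c *: y.
  by move=> e0 e1; apply/rowP=> i; case: (ord2P i) => ->; rewrite mxE.
case/orP: y_neq0 => yi.
  exists (z 0 0 / y 0 0); apply: row2_eqP; first by field.
  by apply: (mulfI yi); rewrite yz; field.
exists (z 0 1 / y 0 1); apply: row2_eqP; last by field.
by apply: (mulfI yi); rewrite -yz; field.
Qed.

(** A Cauchy-Schwarz bound with the constant 2 in place of 1; it bounds the
chordal metric, and also bounds [vnorm y] from below in
[chordal_power_iteration]. *)
Lemma normc_wedge_le y z : normc (wedge y z) <= 2 * (vnorm y * vnorm z).
Proof.
have le_vnorm (i : 'I_2) (t : 'rV[C]_2) : normc (t 0 i) <= vnorm t.
  rewrite /vnorm -[leLHS]ger0_norm ?normc_ge0 // -sqrtr_sqr ler_wsqrtr //.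
  by case: (ord2P i) => ->; rewrite ?lerDl ?lerDr exprn_ge0 ?normc_ge0.
rewrite /wedge; apply: le_trans (le_normcD _ _) _.
rewrite normcN !ComplexField.Normc.normcM mulr_natl mulr2n.
by apply: lerD; apply: ler_pM; rewrite ?normc_ge0 ?le_vnorm.
Qed.

(** Homogeneous coordinates give one formula for the four cases of the chordal
metric. *)
Lemma chordal_sphere_point y z : y != 0 -> z != 0 ->
  chordal_dist (sphere_point y) (sphere_point z) =
    normc (wedge y z) / (vnorm y * vnorm z).
Proof.
have vnorm_fin (t : 'rV[C]_2) : t 0 1 != 0 ->
    vnorm t = normc (t 0 1) * Num.sqrt (1 + normc (t 0 0 / t 0 1) ^+ 2).
  move=> t1; have nt1 : normc (t 0 1) != 0 by rewrite normc_eq0.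
  rewrite ComplexField.Normc.normcM ComplexField.Normc.normcV.
  rewrite -[X in X * _]ger0_norm ?normc_ge0 // -sqrtr_sqr -sqrtrM ?sqr_ge0 //.
  by congr Num.sqrt; field.
have vnorm_inf (t : 'rV[C]_2) : t 0 1 = 0 -> vnorm t = normc (t 0 0).
  move=> t1; rewrite /vnorm t1 ComplexField.Normc.normc0 expr0n addr0 sqrtr_sqr.
  by rewrite ger0_norm ?normc_ge0.
have sqrt_neq0 c : Num.sqrt (1 + normc c ^+ 2) != 0.
  by rewrite gt_eqF // sqrtr_gt0 ltr_pwDl // sqr_ge0.
rewrite !row2_eq0 /sphere_point /sphere_quot /wedge => y_neq0 z_neq0.
have [y1|y1] := eqVneq (y 0 1) 0; have [z1|z1] := eqVneq (z 0 1) 0 => /=.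
- by rewrite y1 z1 mulr0 mul0r subrr ComplexField.Normc.normc0 mul0r.
- rewrite y1 eqxx andbT -normc_eq0 in y_neq0; rewrite -normc_eq0 in z1.
  rewrite vnorm_inf // vnorm_fin -?normc_eq0 // y1 mul0r subr0.
  rewrite (ComplexField.Normc.normcM (y 0 0)).
  by field; rewrite y_neq0 z1 sqrt_neq0.
- rewrite z1 eqxx andbT -normc_eq0 in z_neq0; rewrite -normc_eq0 in y1.
  rewrite vnorm_fin -?normc_eq0 // vnorm_inf // z1 mulr0 sub0r normcN.
  rewrite (ComplexField.Normc.normcM (y 0 1)).
  by field; rewrite z_neq0 y1 sqrt_neq0.
- have -> : y 0 0 * z 0 1 - y 0 1 * z 0 0 =
     - (y 0 1 * z 0 1 * (z 0 0 / z 0 1 - y 0 0 / y 0 1)).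
    by field; rewrite y1 z1.
  rewrite normcN (ComplexField.Normc.normcM (y 0 1 * z 0 1)).
  rewrite (ComplexField.Normc.normcM (y 0 1)) !vnorm_fin //.
  rewrite -!normc_eq0 in y1 z1.
  by field; rewrite y1 z1 !sqrt_neq0.
Qed.

(** Let y be the combination.  The numerator of the distance is
|mu|^k |wedge f g|, because the component of y along f does not contribute;
for the same reason |wedge y g| = |lam|^k |wedge f g|, and [normc_wedge_le]
turns this into the lower bound needed for [vnorm y]. *)
Lemma chordal_power_iteration f g (lam mu : C) k :
    wedge f g != 0 -> lam != 0 ->
  chordal_dist (sphere_point (lam ^+ k *: f + mu ^+ k *: g)) (sphere_point f)
    <= 2 * (vnorm g / vnorm f) * (normc mu / normc lam) ^+ k.
Proof.
move=> fg lam0; have [f0 g0] := (wedge_neq0l fg, wedge_neq0r fg).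
set y := _ + _.
have yg : wedge y g = lam ^+ k * wedge f g by rewrite /wedge !mxE; ring.
have yf : wedge y f = - (mu ^+ k * wedge f g) by rewrite /wedge !mxE; ring.
have y0 : y != 0 by apply: (@wedge_neq0l y g); rewrite yg mulf_neq0 ?expf_neq0.
have nfg : 0 < normc (wedge f g) by rewrite lt_def normc_eq0 fg normc_ge0.
have nlam : 0 < normc lam by rewrite lt_def normc_eq0 lam0 normc_ge0.
have := normc_wedge_le y g.
rewrite yg chordal_sphere_point // yf normcN.
rewrite !ComplexField.Normc.normcM !normcX expr_div_n.
move: y0 f0 g0; rewrite -!vnorm_gt0 => y0 f0 g0 le_y.
rewrite ler_pdivrMr ?mulr_gt0 //.
have lk : 0 < normc lam ^+ k by rewrite exprn_gt0.
have -> : 2 * (vnorm g / vnorm f) * (normc mu ^+ k / normc lam ^+ k)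
   * (vnorm y * vnorm f)
  = normc mu ^+ k * (2 * (vnorm y * vnorm g) / normc lam ^+ k).
  by field; rewrite !gt_eqF.
by rewrite ler_wpM2l ?exprn_ge0 ?normc_ge0 // ler_pdivlMr // mulrC.
Qed.

End SpherePoints.

(** * Limits of sequences *)

Lemma le_limn_inf (R : realType) (u : nat -> R) (c K : R) :
  (forall n, c <= u n <= K) -> c <= limn_inf u.
Proof.
move=> u_itv.
have u_bounded : bounded_fun (u : nat -> R^o).
  exists (`|c| + `|K|); split; first exact: num_real.
  move=> M /ltW le_M n _ /=; apply: le_trans le_M.
  have /andP[cu uK] := u_itv n.
  rewrite ler_norml; apply/andP; split.
    rewrite (le_trans _ cu) // lerNl (le_trans (ler_norm _)) // normrN.
    by rewrite lerDl.
  by rewrite (le_trans uK) // (le_trans (ler_norm _)) // lerDr.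
rewrite limn_infE //; apply: le_trans (ub_le_sup _ (imageT _ 0%N)).
  apply: lb_le_inf; first by exists (u 0%N); exists 0%N.
  by move=> _ [k _ <-]; case/andP: (u_itv k).
exact: bounded_fun_has_ubound_infs.
Qed.

Lemma cvgn_divn d : (0 < d)%N -> (n %/ d)%N @[n --> \oo] --> \oo.
Proof.
move=> d_gt0; apply/cvgnyPge => A; exists (A * d)%N => // n /= le_An.
by rewrite leq_divRL.
Qed.

(** * Periodic continued fractions *)

Section Periodic.
Variable R : realType.
Local Notation C := R[i].
Variables a b : nat -> C.

(** The rows (A_(-1), B_(-1)) = (1, 0) and (A_0, B_0) = (b_0, 1). *)
Definition cf_mx0 : 'M[C]_2 :=
  \matrix_(i, j) if i == 0 then (j == 0)%:R else if j == 0 then b 0 else 1.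

Lemma det_cf_mx0 : \det cf_mx0 = 1.
Proof. by rewrite det_mx2 !mxE /= mul1r mul0r subr0. Qed.

Lemma cf_mx_convergents n :
  cf_mx a b n *m cf_mx0 =
  \matrix_(i, j) if i == 0 then
                   if j == 0 then cf_num_pred a b n else cf_den_pred a b n
                 else if j == 0 then cf_num a b n else cf_den a b n.
Proof.
elim: n => [|n IHn].
  rewrite mul1mx; apply/matrixP=> i j; rewrite !mxE.
  by case: ifP => // _; case: (ord2P j) => ->.
rewrite [cf_mx _ _ _]/= -mulmxA IHn; apply/matrixP=> i j.
rewrite mulmx2E !mxE /cf_num /cf_den /cf_num_pred /cf_den_pred.
case: (ord2P i) => ->; case: (ord2P j) => -> /=;
  rewrite ?mul0r ?mul1r ?add0r //; by case: n {IHn} => [|n] /=; rewrite addrC.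
Qed.

Lemma cf_S_sphere_point n (y : 'rV[C]_2) : y != 0 ->
  cf_S a b n (sphere_point y) = sphere_point (y *m (cf_mx a b n *m cf_mx0)).
Proof.
move=> y_neq0; rewrite /sphere_point cf_mx_convergents !mulmx2E !mxE /=.
rewrite {1}/sphere_quot.
have [y1|y1] := eqVneq (y 0 1) 0 => /=.
  rewrite y1 !mul0r !addr0 sphere_quotZ //.
  by move: y_neq0; rewrite row2_eq0 y1 eqxx andbT.
by rewrite -(sphere_quotZ _ _ y1); congr sphere_quot; field.
Qed.

Variable d : nat.
Hypotheses (d_gt0 : (0 < d)%N)
  (a_neq0 : forall n, (0 < n)%N -> a n != 0)
  (a_per : forall n, (0 < n)%N -> a (n + d)%N = a n)
  (b_per : forall n, (0 < n)%N -> b (n + d)%N = b n).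

Lemma cf_mx_unit n : cf_mx a b n \in unitmx.
Proof.
rewrite unitmxE det_cf_mx unitfE big_seq prodf_seq_neq0; apply/allP => i.
by rewrite mem_index_iota oppr_eq0 => /andP[i0 _]; rewrite a_neq0 ?implybT.
Qed.

(** By periodicity the last [r] steps have the same product as the first [r]
ones; they act first and send [y] to [f], which each of the [k] periods then
multiplies by [lam]. *)
Lemma cf_mx_period (y f : 'rV[C]_2) (lam : C) r k :
    y *m cf_mx a b r = f -> f *m cf_mx a b d = lam *: f ->
  y *m cf_mx a b (r + k * d) = lam ^+ k *: f.
Proof.
move=> yf fM; elim: k => [|k IHk]; first by rewrite addn0 expr0 scale1r.
rewrite mulSn addnCA addnC cf_mxD.
rewrite (@eq_cf_mx _ _ _ a b) => [|i /andP[i0 _]]; last by rewrite a_per ?b_per.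
by rewrite mulmxA IHk -scalemxAl fM scalerA exprSr.
Qed.

(** The limit is the attracting fixed point of the period: the eigenvector of
[lam], transported by [cf_mx0]. *)
Theorem periodic_cf_converges_generally (lam mu : C) :
    eigenvalue (cf_mx a b d) lam -> eigenvalue (cf_mx a b d) mu ->
    normc mu < normc lam ->
  cf_converges_generally a b.
Proof.
move=> /eigenvalueP[f fM f0] /eigenvalueP[g gM g0] lt_mu_lam.
have lam0 : lam != 0.
  by rewrite -normc_eq0 gt_eqF // (le_lt_trans (normc_ge0 _) lt_mu_lam).
(* eigenvectors for distinct eigenvalues are independent *)
have fg : wedge f g != 0.
  apply/eqP=> /(wedge_eq0 f0)[c gE].
  have c0 : c != 0 by apply: contraNneq g0 => c0; rewrite gE c0 scale0r.
  have := gM; rewrite gE -scalemxAl fM !scalerA mulrC => /eqP.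
  rewrite -subr_eq0 -scalerBl scaler_eq0 (negPf f0) orbF subr_eq0 => /eqP lm.
  by move: lt_mu_lam; rewrite (mulIf c0 lm) ltxx.
pose f' := f *m cf_mx0; pose g' := g *m cf_mx0.
have fg' : wedge f' g' != 0 by rewrite wedgeM det_cf_mx0 mulr1.
pose v r := f *m invmx (cf_mx a b r).
pose w r := (f + g) *m invmx (cf_mx a b r).
have vE r : v r *m cf_mx a b r = f by rewrite /v mulmxKV // cf_mx_unit.
have wE r : w r *m cf_mx a b r = f + g by rewrite /w mulmxKV // cf_mx_unit.
have vw r : wedge (v r) (w r) != 0.
  rewrite wedgeM mulf_neq0 //; last first.
    by rewrite -unitfE -unitmxE unitmx_inv cf_mx_unit.
  have -> // : wedge f (f + g) = wedge f g by rewrite /wedge !mxE; ring.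
have v0 r := wedge_neq0l (vw r); have w0 r := wedge_neq0r (vw r).
have nE n : (n %% d + n %/ d * d)%N = n by rewrite addnC -divn_eq.
(* v stays at the fixed point; w starts from f + g and is driven to f *)
have SvE n : cf_S a b n (sphere_point (v (n %% d)%N)) = sphere_point f'.
  rewrite (cf_S_sphere_point _ (v0 _)) mulmxA -[in cf_mx a b n](nE n).
  rewrite (cf_mx_period _ (vE _) fM) -scalemxAl sphere_point_scale //.
  exact: expf_neq0.
have SwE n : cf_S a b n (sphere_point (w (n %% d)%N)) =
    sphere_point (lam ^+ (n %/ d) *: f' + mu ^+ (n %/ d) *: g').
  rewrite (cf_S_sphere_point _ (w0 _)) mulmxA -[in cf_mx a b n](nE n).
  pose gr := w (n %% d)%N - v (n %% d)%N.
  have grE : gr *m cf_mx a b (n %% d) = g by rewrite mulmxBl wE vE addrC addKr.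
  rewrite -[w _](subrK (v (n %% d)%N)) -/gr addrC mulmxDl.
  rewrite (cf_mx_period _ (vE _) fM) (cf_mx_period _ grE gM) mulmxDl.
  by rewrite -!scalemxAl.
exists (sphere_point f'), (fun n => sphere_point (v (n %% d)%N)),
  (fun n => sphere_point (w (n %% d)%N)); split.
(* v and w are d-periodic, so the distance takes finitely many values *)
- pose D r := chordal_dist (sphere_point (v r)) (sphere_point (w r)).
  have D_gt0 r : 0 < D r.
    rewrite /D chordal_sphere_point // divr_gt0 ?mulr_gt0 ?vnorm_gt0 //.
    by rewrite lt_def normc_eq0 vw normc_ge0.
  have D_le2 r : D r <= 2.
    rewrite /D chordal_sphere_point // ler_pdivrMr ?mulr_gt0 ?vnorm_gt0 //.
    exact: normc_wedge_le.
  apply: (@lt_le_trans _ _ (\big[Order.min/1]_(r < d) D r)).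
    by apply/bigmin_gtP; split.
  apply: (@le_limn_inf _ _ _ 2) => n; rewrite D_le2 andbT.
  exact: (bigmin_le _ (Ordinal (ltn_pmod n d_gt0))).
- rewrite (_ : (fun n => _) = cst 0); first exact: cvg_cst.
  apply/funext => n; rewrite SvE chordal_sphere_point ?(wedge_neq0l fg') //.
  by rewrite /wedge [X in _ - X]mulrC subrr ComplexField.Normc.normc0 mul0r.
- pose u := geometric (2 * (vnorm g' / vnorm f')) (normc mu / normc lam).
  have u0 : u (n %/ d)%N @[n --> \oo] --> 0.
    apply: cvg_comp (cvgn_divn d_gt0) _; apply: cvg_geometric.
    rewrite ger0_norm ?divr_ge0 ?normc_ge0 // ltr_pdivrMr ?mul1r //.
    by rewrite lt_def normc_eq0 lam0 normc_ge0.
  apply: squeeze_cvgr (cvg_cst 0) u0.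
  apply: nearW => n; rewrite SwE chordal_power_iteration // andbT.
  rewrite chordal_sphere_point ?(wedge_neq0l fg') //.
    by rewrite divr_ge0 ?normc_ge0 // mulr_ge0 // sqrtr_ge0.
  apply: (@wedge_neq0l _ _ g').
  have -> : wedge (lam ^+ (n %/ d) *: f' + mu ^+ (n %/ d) *: g') g' =
      lam ^+ (n %/ d) * wedge f' g' by rewrite /wedge !mxE; ring.
  by rewrite mulf_neq0 ?expf_neq0.
Qed.

End Periodic.

(** * The Rogers-Ramanujan period at a root of unity *)

Section RootOfUnity.
Variables (F : fieldType) (d : nat) (x : F).
Hypothesis prim_x : d.-primitive_root x.

Let d_gt0 : (0 < d)%N := prim_order_gt0 prim_x.

(** The powers of [x] over one period are all the roots of X^d - 1, whose
constant coefficient is -1. *)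
Lemma det_cf_mx_root_of_unity : \det (cf_mx (fun n => x ^+ n) (fun=> 1) d) = -1.
Proof.
have prod0 : \prod_(0 <= i < d) (- x ^+ i) = -1.
  transitivity (('X^d - 1 : {poly F}).[0]); last first.
    by rewrite !hornerE expr0n gtn_eqF //= sub0r.
  rewrite -(factor_Xn_sub_1 prim_x) horner_prod.
  by apply: eq_bigr => i _; rewrite !hornerE.
rewrite det_cf_mx -[RHS]prod0; apply/eqP; rewrite -eqr_opp -mulN1r; apply/eqP.
rewrite -[in LHS](expr0 x) -(@big_ltn _ _ _ 0 d.+1 (fun i => - x ^+ i)) //.
by rewrite big_nat_recr //= (prim_expr_order prim_x) mulrN1.
Qed.

(** Deform the numerators to x^n z: the trace becomes a polynomial in z of
degree less than [d], invariant under z |-> x z, hence constant. *)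
Lemma tr_cf_mx_root_of_unity : \tr (cf_mx (fun n => x ^+ n) (fun=> 1) d) = 1.
Proof.
pose t z := \tr (cf_mx (fun n => x ^+ n * z) (fun=> 1) d).
pose p : {poly F} := \tr (cf_mx (fun n => x ^+ n *: 'X) (fun=> 1) d).
have pE z : p.[z] = t z.
  rewrite -[p.[z]]/(horner_eval z p) -trace_map_mx map_cf_mx.
  congr (\tr _); apply: eq_cf_mx => i _.
  by rewrite /= /horner_eval hornerZ hornerX hornerC.
have t_rot z : t (x * z) = t z.
  rewrite /t -(@tr_cf_mx_rot _ (fun n => x ^+ n * z)) //; last first.
    by rewrite exprS (prim_expr_order prim_x) mulr1 expr1.
  by congr (\tr _); apply: eq_cf_mx => i _; rewrite exprSr mulrA.
have tX j : t (x ^+ j) = t 1.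
  by elim: j => [|j IHj]; rewrite ?expr0 // exprS t_rot.
have p_const : p = (t 1)%:P.
  apply/eqP; rewrite -subr_eq0; apply/eqP.
  apply: (@roots_geq_poly_eq0 _ _ [seq x ^+ j | j <- iota 0 d]).
  - apply/allP=> _ /mapP[j _ ->].
    by rewrite /root !hornerE pE tX subrr.
  - rewrite map_inj_in_uniq ?iota_uniq // => i j.
    rewrite !mem_iota /= !add0n => lt_id lt_jd /eqP.
    by rewrite (eq_prim_root_expr prim_x) !modn_small // => /eqP.
  - rewrite size_map size_iota.
    apply: leq_trans (size_polyD _ _) _; rewrite geq_max size_polyN.
    rewrite (leq_trans (size_polyC_leq1 _)) // andbT.
    apply: size_tr_cf_mx => // i; last by rewrite size_poly1.
    by apply: leq_trans (size_scale_leq _ _) _; rewrite size_polyX.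
have <- : t 1 = \tr (cf_mx (fun n => x ^+ n) (fun=> 1) d).
  by congr (\tr _); apply: eq_cf_mx => i _; rewrite mulr1.
(* at z = 0 every step is the same idempotent matrix, of trace 1 *)
have -> : t 1 = t 0 by rewrite -pE p_const hornerC -(pE 0) p_const hornerC.
rewrite /t; case: d d_gt0 => [//|n] _.
suff -> : cf_mx (fun k => x ^+ k * 0) (fun=> 1) n.+1 = cf_step 0 1.
  by rewrite tr_mx2 !mxE /= add0r.
elim: n => [|n IHn]; first by rewrite /= mulmx1 mulr0.
rewrite [LHS]/= -/(cf_mx _ _ n.+1) [X in _ *m X]IHn mulr0.
by apply/matrixP=> i j; rewrite mulmx2E !mxE; case: (ord2P i) => ->;
  case: (ord2P j) => ->; rewrite /= ?mul0r ?mul1r ?add0r.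
Qed.

End RootOfUnity.

Theorem proposition1 (R : realType) (m : nat) (x : R[i])
    (m_gt0 : (0 < m)%N) (m_mod5 : m = 0 %[mod 5]) (x_root : m.-unity_root x) :
  K_converges_generally x.
Proof.
have [d prim_x _] := prim_order_exists m_gt0 (unity_rootP x_root).
have d_gt0 := prim_order_gt0 prim_x.
have x_neq0 : x != 0.
  by rewrite (prim_root_eq0 prim_x) gtn_eqF.
pose s : R := Num.sqrt 5.
have s2 : s ^+ 2 = 5 by rewrite sqr_sqrtr.
have s1 : 1 < s by rewrite -sqrtr1 ltr_sqrt // ltr1n.
(* for e = 1 and e = -1, the two roots of X^2 - X - 1 *)
pose golden (e : R) : R[i] := ((1 + e * s) / 2)%:C.
have golden_eigen e : e ^+ 2 = 1 ->
    eigenvalue (cf_mx (K_num x) (@K_den R) d) (golden e).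
  move=> e2; rewrite eigenvalue_mx2 (det_cf_mx_root_of_unity prim_x).
  rewrite (tr_cf_mx_root_of_unity prim_x) mul1r.
  have -> : golden e ^+ 2 - golden e + -1 = ((e ^+ 2 * s ^+ 2 - 5) / 4)%:C.
    rewrite /golden -rmorphXn -rmorphB -(rmorph1 (real_complex R)) -rmorphB.
    by congr _%:C; field.
  by rewrite e2 s2 mul1r subrr mul0r.
have normc_golden e : normc (golden e) = `|(1 + e * s) / 2|.
  by rewrite /= expr0n addr0 sqrtr_sqr.
apply: (@periodic_cf_converges_generally _ _ _ d _ _ _ _
          (golden 1) (golden (-1))).
- exact: d_gt0.
- by move=> n _; exact: expf_neq0.
- by move=> n _; rewrite /K_num exprD (prim_expr_order prim_x) mulr1.
- by [].
- by apply: golden_eigen; rewrite expr1n.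
- by apply: golden_eigen; rewrite sqrrN expr1n.
- rewrite !normc_golden !normrM ltr_pM2r ?normr_gt0 //.
  rewrite mul1r mulN1r ltr0_norm ?subr_lt0 // ger0_norm; lra.
Qed.
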